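(* Let $X$ be a real or complex Banach space, let $U:\Delta_{+}\to\mathcal{B}(X)$ be an evolution operator, and let $p>0$ be a real constant. If $U$ has a strong exponential dichotomy with the dichotomy projection $P:\mathbb{R}_{+}\to\mathcal{B}(X)$, then $U$ has $P$-exponential growth and there exist three constants $K\geq 1$, $\delta\geq 0$ and $\gamma>0$ such that $$\int_{0}^{\infty}e^{p\gamma|\tau-t|}\,\|G(\tau,t)x\|^{p}\,d\tau\leq K e^{p\delta t}\|x\|^{p}\quad\text{for all } t\geq 0 \text{ and } x\in X,$$ where $G$ is the Green function of $U$ and $P(\cdot)$.
   Context: Let $X$ be a real or complex Banach space, $\mathcal{B}(X)$ the Banach algebra of bounded linear operators on $X$, and $\Delta_{+}=\{(t,s)\in\mathbb{R}_{+}\times\mathbb{R}_{+}: t\geq s\}$, where $\mathbb{R}_+=[0,\infty)$. Evolution operator: a map $U:\Delta_{+}\to\mathcal{B}(X)$ with $U(t,t)=Id$ for all $t\ge 0$; $U(t,s)U(s,t_0)=U(t,t_0)$ for all $t\geq s\geq t_0\ge 0$; and $(t,s)\mapsto U(t,s)x$ continuous on $\Delta_{+}$ for every $x\in X$. Projection valued function: a strongly continuous map $P:\mathbb{R}_{+}\to\mathcal{B}(X)$ with $P(t)^2=P(t)$ for all $t$; write $Q(t)=Id-P(t)$, so $\operatorname{Ker}P(t)=\operatorname{Range}Q(t)$. Compatibility: $P(\cdot)$ is compatible with $U$ if $P(t)U(t,s)=U(t,s)P(s)$ for all $(t,s)\in\Delta_{+}$ and the restriction $U(t,s)|_{\operatorname{Ker}P(s)}:\operatorname{Ker}P(s)\to\operatorname{Ker}P(t)$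 is an isomorphism for each $(t,s)\in\Delta_{+}$; its inverse is denoted $V(s,t):\operatorname{Ker}P(t)\to\operatorname{Ker}P(s)$. Strong exponential dichotomy: $U$ has a strong exponential dichotomy if there are a projection valued function $P$ compatible with $U$ and constants $N\geq1$, $\alpha\geq0$, $\beta>0$ with $\|U(t,s)P(s)\|\leq Ne^{\alpha s}e^{-\beta(t-s)}$ and $\|V(s,t)Q(t)\|\leq Ne^{\alpha s}e^{-\beta(t-s)}$ for all $(t,s)\in\Delta_{+}$; such a $P(\cdot)$ is called the dichotomy projection. $P$-exponential growth: for $P$ compatible with $U$, $U$ has $P$-exponential growth if there exist $M\geq1$, $\varepsilon\geq0$, $\omega>0$ with $\|U(t,s)P(s)\|\leq Me^{\varepsilon s}e^{\omega(t-s)}$ and $\|V(s,t)Q(t)\|\leq Me^{\varepsilon s}e^{\omega(t-s)}$ for all $(t,s)\in\Delta_{+}$. Green function of $U$ and a compatible $P(\cdot)$: $G(t,s)=U(t,s)P(s)$ for $t>s\geq0$, and $G(t,s)=-V(t,s)Q(s)$ for $s>t\geq0$. *)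

(* Defs.v *)
From mathcomp Require Import all_boot all_order all_algebra.
From mathcomp Require Import all_classical all_reals all_analysis.
From mathcomp Require Import complex.
Set Implicit Arguments.
Unset Strict Implicit.
Unset Printing Implicit Defensive.
Import Order.TTheory GRing.Theory Num.Theory.
Import numFieldNormedType.Exports.
Local Open Scope classical_set_scope.
Local Open Scope ring_scope.

(* [scalars re] says that the scalar field [K] is [R] or [R[i]]. The norm of a
   [normedModType K] takes its values in [K] (nonnegative reals inside [R[i]] in
   the complex case); [re] reads it back as an element of [R]. *)
Variant scalars (R : realType) : forall K : numFieldType, (K -> R) -> Prop :=
| RealScalars : @scalars R R id
| ComplexScalars : @scalars R R[i] (@complex.Re R).

Record bounded_operator (K : numFieldType) (X : normedModType K) :=
  BoundedOperator {
    linear_of :> {linear X -> X};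
    _ : bounded_near linear_of (nbhs (0 : X)) }.

Section EvolutionOperators.
Context {R : realType} {K : numFieldType} (re : K -> R).
Context {X : completeNormedModType K}.
Implicit Types (U : R -> R -> bounded_operator X) (P : R -> bounded_operator X).

Definition rnorm (x : X) : R := re `|x|.

Definition opnorm (f : X -> X) : R :=
  sup [set rnorm (f x) | x in [set x : X | `|x| <= 1]].

(* Functions on R_+ and on Delta_+ are represented by total functions on [R] and
   [R * R]; only the values at nonnegative times (with t >= s) are ever used. *)
Definition Delta : set (R * R) := [set ts | 0 <= ts.2 /\ ts.2 <= ts.1].

Definition evolution_operator U : Prop :=
  [/\ forall t, 0 <= t -> forall x, U t t x = x,
      forall t s t0, 0 <= t0 -> t0 <= s -> s <= t ->
        forall x, U t s (U s t0 x) = U t t0 x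
    & forall x, {within Delta, continuous (fun ts => U ts.1 ts.2 x)}].

Definition projection_valued P : Prop :=
  (forall x, {within `[0, +oo[, continuous (fun t => P t x)}) /\
  (forall t, 0 <= t -> forall x, P t (P t x) = P t x).

Definition Q P (t : R) (x : X) : X := x - P t x.

Definition Ker (f : X -> X) : set X := [set x | f x = 0].

(* For t >= s, the inverse Ker P(t) -> Ker P(s) of the restriction of U(t,s);
   its values outside Ker P(t) are irrelevant. *)
Definition V U P (s t : R) : X -> X :=
  'pinv_(fun=> 0) (Ker (P s)) (U t s).

Definition compatible U P : Prop :=
  forall t s, Delta (t, s) ->
    [/\ forall x, P t (U t s x) = U t s (P s x),
        set_bij (Ker (P s)) (Ker (P t)) (U t s)
      & {within Ker (P t), continuous (V U P s t)}].

Definition strong_exponential_dichotomy U P : Prop :=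
  [/\ projection_valued P, compatible U P
    & exists N alpha beta : R, [/\ 1 <= N, 0 <= alpha, 0 < beta
      & forall t s, Delta (t, s) ->
        opnorm (U t s \o P s)
          <= N * expR (alpha * s) * expR (- (beta * (t - s))) /\
        opnorm (V U P s t \o Q P t)
          <= N * expR (alpha * s) * expR (- (beta * (t - s)))]].

Definition exponential_growth U P : Prop :=
  [/\ projection_valued P, compatible U P
    & exists M epsilon omega : R, [/\ 1 <= M, 0 <= epsilon, 0 < omega
      & forall t s, Delta (t, s) ->
        opnorm (U t s \o P s)
          <= M * expR (epsilon * s) * expR (omega * (t - s)) /\
        opnorm (V U P s t \o Q P t)
          <= M * expR (epsilon * s) * expR (omega * (t - s))]].

(* The Green function is not defined on the diagonal; the value 0 chosen there
   only affects integrands at a single point. *)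
Definition Green U P (t s : R) (x : X) : X :=
  if s < t then U t s (P s x)
  else if t < s then - V U P t s (Q P s x)
  else 0.

End EvolutionOperators.

(* Main.v *)
Require Import Defs.
From mathcomp Require Import all_boot all_order all_algebra.
From mathcomp Require Import all_classical all_reals all_analysis.
From mathcomp Require Import complex measurable_realfun ring lra.
Set Implicit Arguments.
Unset Strict Implicit.
Unset Printing Implicit Defensive.
Import Order.TTheory GRing.Theory Num.Theory.
Import numFieldNormedType.Exports.
Local Open Scope classical_set_scope.
Local Open Scope ring_scope.

(** The growth bounds are the dichotomy bounds themselves, since
    [e^(-beta (t - s)) <= e^(beta (t - s))].

    For the integral estimate, both branches of the Green function satisfy
    [|G(tau,t)x| <= N e^(alpha t) e^(-beta |tau - t|) |x|]
    ([rnorm_Green_le]); when [tau < t] the dichotomy gives the weight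
    [e^(alpha tau)], which is at most [e^(alpha t)]. Spending half of the decay
    on the weight, that is taking [gamma = beta / 2], leaves the integrand below
    [N^p e^(p alpha t) |x|^p e^(-p (beta/2) |tau - t|)], whose integral over the
    whole line is explicit ([integral_expR_dist]): the constant is
    [N^p * 2 / (p beta / 2)], raised to [1] if smaller.

    Two points need care. A bound on [opnorm f], a supremum of reals, controls
    [|f x|] only if the set under the supremum is bounded; [ler_opnorm] gets this
    from continuity of [f] at [0], and for [V(s,t)Q(t)] that continuity is the
    topological half of compatibility. Measurability of [tau |-> |G(tau,t)x|] is
    clear after [t], where it is an orbit of [U]; before [t] it is an orbit of
    [U] as well, since [V(tau,t) = U(tau,0) V(0,t)] ([V_transport]). *)

(** * Real-valued norms and operator norms *)

(** Both kinds of scalars are used only through an ordered embedding of the reals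
    that [re] inverts; this treats the real and the complex case together. *)
Lemma scalars_embedding (R : realType) (K : numFieldType) (re : K -> R) :
  scalars re ->
  exists i : {rmorphism R -> K},
    [/\ {mono i : x y / x <= y}, cancel i re
      & forall z, 0 <= z -> i (re z) = z].
Proof.
case; first by exists idfun.
exists (real_complex R); split => [x y|//|z z0]; first exact: lecR.
by apply: RRe_real; exact: ger0_real.
Qed.

Lemma continuous_bounded_operator (K : numFieldType) (X : normedModType K)
  (T : bounded_operator X) : continuous T.
Proof. by case: T => f bf; exact/linear_bounded_continuous. Qed.

Section ScalarNorm.
Context {R : realType} {K : numFieldType} {re : K -> R} (hK : scalars re).
Context {X : completeNormedModType K}.
Implicit Types (x y : X) (f : X -> X).

Lemma rnorm0 : rnorm re (0 : X) = 0.
Proof.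
have [i [_ iK _]] := scalars_embedding hK.
by rewrite /rnorm normr0 -(rmorph0 i) iK.
Qed.

Lemma ler_rnorm x y : (rnorm re x <= rnorm re y) = (`|x| <= `|y|).
Proof.
have [i [mi _ reK]] := scalars_embedding hK.
by rewrite -mi !reK.
Qed.

Lemma rnorm_ge0 x : 0 <= rnorm re x.
Proof. by rewrite -rnorm0 ler_rnorm normr0. Qed.

Lemma rnormN x : rnorm re (- x) = rnorm re x.
Proof. by rewrite /rnorm normrN. Qed.

Lemma ler_rnormD x y : rnorm re (x + y) <= rnorm re x + rnorm re y.
Proof.
have [i [mi _ reK]] := scalars_embedding hK.
by rewrite -mi rmorphD !reK ?ler_normD.
Qed.

Lemma ler_dist_rnorm x y : `|rnorm re x - rnorm re y| <= rnorm re (x - y).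
Proof.
rewrite ler_norml; apply/andP; split.
  rewrite -rnormN opprB lerNl opprB lerBlDr.
  by rewrite -{1}(subrK x y) ler_rnormD.
by rewrite lerBlDr -{1}(subrK y x) ler_rnormD.
Qed.

Lemma continuous_rnorm : continuous (rnorm re : X -> R).
Proof.
have [i [mi _ reK]] := scalars_embedding hK.
have lti : {mono i : a b / a < b} by exact: leW_mono.
move=> x; apply/cvgrPdist_lt => e e0.
have ie0 : 0 < i e by rewrite -(rmorph0 i) lti.
have /cvgrPdist_lt/(_ _ ie0) : y @[y --> x] --> x by exact: cvg_id.
apply: filterS => y; rewrite -(reK `|x - y|)// lti.
exact: le_lt_trans (ler_dist_rnorm x y).
Qed.

(** Continuity at [0] bounds [f] on a small ball, hence on the unit ball by
    homogeneity, so the supremum defining [opnorm] is that of a bounded set. The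
    function is not bundled as a linear map so that the lemma applies to
    [V(s,t)Q(t)], built from a partial inverse. *)
Lemma ler_opnorm f :
  (forall (a : K) x, f (a *: x) = a *: f x) -> f y @[y --> 0] --> (0 : X) ->
  forall x, rnorm re (f x) <= opnorm re f * rnorm re x.
Proof.
have [i [mi iK reK]] := scalars_embedding hK.
have lti : {mono i : a b / a < b} by exact: leW_mono.
move=> fZ f0.
have f00 : f 0 = 0 by have := fZ 0 0; rewrite !scale0r.
have rZ a x : 0 <= a -> rnorm re (i a *: x) = a * rnorm re x.
  move=> a0; apply: (can_inj iK); rewrite rmorphM !reK// normrZ ger0_norm//.
  by rewrite -(rmorph0 i) mi.
have bnd : exists M, forall x, `|x| <= 1 -> rnorm re (f x) <= M.
  move: f0 => /cvgrPdist_lt/(_ 1 ltr01).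
  rewrite near_map => /nbhs_normP[d /= d0 fd].
  have [r dE] : exists r, d = i r by exists (re d); rewrite reK// ltW.
  have r0 : 0 < r by move: d0; rewrite dE -(rmorph0 i) lti.
  exists (2 / r) => x x1.
  have r20 : 0 <= r / 2 by rewrite divr_ge0 ?ltW.
  have /fd : ball_ Num.norm 0 d (i (r / 2) *: x).
    rewrite /ball_/= sub0r normrN -[ltLHS]reK// dE lti -/(rnorm _ _) rZ//.
    have : rnorm re x <= 1 by rewrite -mi reK// rmorph1.
    by rewrite -(ler_pM2l r0) => h; lra.
  rewrite /= fZ sub0r normrN -[ltLHS]reK// -(rmorph1 i) lti -/(rnorm _ _) rZ//.
  by move=> h; rewrite ler_pdivlMr//; lra.
move=> x; have [->|x0] := eqVneq x 0; first by rewrite f00 rnorm0 mulr0.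
have rx0 : 0 < rnorm re x.
  by rewrite -lti rmorph0 reK// normr_gt0.
set u := i (rnorm re x)^-1 *: x.
have xE : x = i (rnorm re x) *: u.
  by rewrite scalerA -rmorphM divff ?gt_eqF// rmorph1 scale1r.
rewrite {1}xE fZ rZ ?rnorm_ge0// mulrC ler_pM2r//.
have [M fM] := bnd.
apply: ub_le_sup.
  by exists M => _ [y /= y1 <-]; exact: fM.
exists u => //=.
rewrite -(reK `|u|)// -(rmorph1 i) mi -/(rnorm _ _) rZ ?invr_ge0 ?rnorm_ge0//.
by rewrite mulVf ?gt_eqF.
Qed.

End ScalarNorm.

(** * Integral of a two-sided exponential *)

Lemma continuous_expR_dist (R : realType) (c t : R) :
  continuous (fun x : R => expR (- (c * `|x - t|))).
Proof.
move=> x; apply: (@continuous_comp _ _ _ (fun x => - (c * `|x - t|)) expR);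
  last exact: continuous_expR.
apply: cvgN; apply: cvgMl_tmp; apply: cvg_norm.
by apply: cvgB; [exact: cvg_id|exact: cvg_cst].
Qed.

(** Translation and parity reduce the integral to twice the mass of an exponential
    density on the half-line, divided by its rate. *)
Lemma integral_expR_dist (R : realType) (c t : R) : 0 < c ->
  (\int[lebesgue_measure]_x (expR (- (c * `|x - t|)))%:E = (2 / c)%:E)%E.
Proof.
move=> c0.
have dF (x : R) : derivable (fun x : R => x - t) x 1 by [].
have dFE : (fun x : R => x - t)^`()%classic = cst 1.
  by apply/funext => x; rewrite derive1E deriveB// derive_id derive_cst subr0.
transitivity (\int[lebesgue_measure]_x (expR (- (c * `|x|)))%:E)%E.
  rewrite [RHS](@increasing_ge0_integration_by_substitutionT _ (fun x => x - t))//.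
  - by apply: eq_integral => x _; rewrite /= dFE !fctE/= mulr1.
  - by move=> x y xy; rewrite ltrD2r.
  - by rewrite dFE => x; exact: cvg_cst.
  - by rewrite dFE; exact: is_cvg_cst.
  - by rewrite dFE; exact: is_cvg_cst.
  - exact: cvg_addrr_Ny.
  - exact: cvg_addrr.
  - by have := @continuous_expR_dist R c 0; under eq_fun do rewrite subr0.
rewrite ge0_symfun_integralT//; last 2 first.
- by have := @continuous_expR_dist R c 0; under eq_fun do rewrite subr0.
- by move=> x /=; rewrite normrN.
have -> : [set x : R | 0 <= x] = `[0, +oo[%classic by rewrite -set_itvcy.
rewrite EFinM; congr (_ * _)%E.
have := integral_exponential_pdf c0.
have -> : (\int[lebesgue_measure]_x (exponential_pdf c x)%:E =
   c%:E * \int[lebesgue_measure]_(x in `[0%R, +oo[) (expR (- (c * `|x|)))%:E)%E.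
  rewrite -ge0_integralZl//=; last 2 first.
  - apply/measurable_EFinP; apply: measurable_funTS.
    apply: continuous_measurable_fun.
    by have := @continuous_expR_dist R c 0; under eq_fun do rewrite subr0.
  - by rewrite lee_fin ltW.
  rewrite [RHS]integral_mkcond; apply: eq_integral => x _.
  rewrite /exponential_pdf !patchE; case: ifPn => //.
  rewrite inE/= in_itv/= andbT => x0.
  by rewrite ger0_norm// mulNr.
set I := (\int[_]_(_ in _) _)%E => h.
have cu : (c%:E * (c^-1)%:E = 1)%E by rewrite -EFinM divff ?gt_eqF.
by rewrite -[LHS]mul1e -cu muleAC h mul1e.
Qed.

(** * The Green function of a dichotomy *)

Section Dichotomy.
Context {R : realType} {K : numFieldType} {re : K -> R} (hK : scalars re).
Context {X : completeNormedModType K}.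
Context {U : R -> R -> bounded_operator X} {P : R -> bounded_operator X}.
Context (hU : evolution_operator U) (hP : projection_valued P).
Context (hUP : compatible U P).
Implicit Types (r s t : R) (x y z : X).

Lemma Q_Ker t x : 0 <= t -> Ker (P t) (Q P t x).
Proof.
by move=> t0; rewrite /Ker/= /Q linearB/= hP.2// subrr.
Qed.

Lemma V_Ker t s y : 0 <= s <= t -> Ker (P t) y -> Ker (P s) (V U P s t y).
Proof.
move=> /andP[s0 st] yK; have [_ bij _] := hUP (conj s0 st : Delta (t, s)).
by have [homo _ _] := bijpinv_bij (fun=> 0) bij; apply: homo.
Qed.

Lemma VK t s y : 0 <= s <= t -> Ker (P t) y -> U t s (V U P s t y) = y.
Proof.
move=> /andP[s0 st] yK; have [_ [_ _ surj] _] := hUP (conj s0 st : Delta (t, s)).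
by rewrite (surjpK _ surj)// inE.
Qed.

Lemma UK t s z : 0 <= s <= t -> Ker (P s) z -> V U P s t (U t s z) = z.
Proof.
move=> /andP[s0 st] zK; have [_ [_ inj _] _] := hUP (conj s0 st : Delta (t, s)).
by rewrite /V (pinvKV _ inj)// inE.
Qed.

Lemma U_Ker t s z : 0 <= s <= t -> Ker (P s) z -> Ker (P t) (U t s z).
Proof.
move=> /andP[s0 st] zK; have [_ [homo _ _] _] := hUP (conj s0 st : Delta (t, s)).
exact: homo.
Qed.

Lemma KerZ t (a : K) y : Ker (P t) y -> Ker (P t) (a *: y).
Proof. by rewrite /Ker/= linearZ/= => ->; rewrite scaler0. Qed.

Lemma VZ t s (a : K) y : 0 <= s <= t -> Ker (P t) y ->
  V U P s t (a *: y) = a *: V U P s t y.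
Proof.
move=> st yK; rewrite -{1}(VK st yK) -[a *: U _ _ _]linearZ/= UK//.
exact/KerZ/V_Ker.
Qed.

(** Both sides lie in [Ker P(s)] and [U(t,s)] maps both to [y]. The point is to
    trade the dependence of [V] on its first time for that of [U], which is
    strongly continuous by definition. *)
Lemma V_transport t s y : 0 <= s <= t -> Ker (P t) y ->
  V U P s t y = U s 0 (V U P 0 t y).
Proof.
move=> /andP[s0 st] yK.
have t0 : 0 <= t by exact: le_trans st.
have vK : Ker (P 0) (V U P 0 t y) by apply: V_Ker; rewrite ?lexx.
have uK : Ker (P s) (U s 0 (V U P 0 t y)) by apply: U_Ker; rewrite ?lexx.
have [_ coc _] := hU.
rewrite -[in LHS](@VK t 0 y) ?lexx//.
by rewrite -(coc t s 0)// UK// s0.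
Qed.

Lemma ler_opnorm_stable t s x : 0 <= s <= t ->
  rnorm re (U t s (P s x)) <= opnorm re (U t s \o P s) * rnorm re x.
Proof.
move=> st; apply: (@ler_opnorm _ _ re hK X (U t s \o P s)) => [a y|/=].
  by rewrite /= !linearZ.
have /= : {for 0, continuous (U t s \o P s)}.
  by apply: continuous_comp; exact: continuous_bounded_operator.
by rewrite /prop_for /continuous_at/= !linear0.
Qed.

(** Since [Q(t)] maps into [Ker P(t)], continuity of [V(s,t)] relative to that
    kernel gives plain continuity of the composite at [0]. *)
Lemma ler_opnorm_unstable t s x : 0 <= s <= t ->
  rnorm re (V U P s t (Q P t x)) <= opnorm re (V U P s t \o Q P t) * rnorm re x.
Proof.
move=> st; have /andP[s0 st'] := st; have t0 : 0 <= t by exact: le_trans st'.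
have K0 : Ker (P t) (0 : X) by rewrite /Ker/= linear0.
have V0 : V U P s t 0 = 0 by have := @VZ t s 0 0 st K0; rewrite !scale0r.
apply: (@ler_opnorm _ _ re hK X (V U P s t \o Q P t)) => [a y|/=].
  rewrite /= /Q linearZ/= -scalerBr VZ//; exact: Q_Ker.
have cV : V U P s t @ within (Ker (P t)) (nbhs 0) --> (0 : X).
  rewrite -[X in _ --> X]V0.
  by have [_ _ /subspace_continuousP/(_ _ K0)] := hUP (conj s0 st' : Delta (t, s)).
suff cQ : Q P t y @[y --> 0] --> within (Ker (P t)) (nbhs 0).
  exact: (cvg_comp _ _ cQ cV).
move=> W /= W0.
have : Q P t y @[y --> 0] --> (0 : X).
  have h : (y - P t y) @[y --> 0] --> 0 - P t 0.
    apply: cvgB; [exact: cvg_id|exact: continuous_bounded_operator].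
  by move: h; rewrite linear0 subrr.
move=> /(_ _ W0); apply: (@filterS _ (nbhs (0 : X))) => y yW; exact: yW (Q_Ker y t0).
Qed.

Lemma continuous_orbit t z : 0 <= t ->
  {within `[t, +oo[, continuous (fun tau => U tau t z)}.
Proof.
move=> t0; have [_ _ /(_ z)/subspace_continuousP cU] := hU.
apply/subspace_continuousP => r; rewrite /= in_itv/= andbT => tr.
suff pair : (tau, t) @[tau --> within `[t, +oo[ (nbhs r)] --> within Delta (nbhs (r, t)).
  exact: (cvg_comp _ _ pair (cU (r, t) (conj t0 tr))).
move=> W /= W0.
have : (tau, t) @[tau --> r] --> (r, t).
  exact: (cvg_pair (G := nbhs r) (H := nbhs t) cvg_id (cvg_cst t)).
move=> /(_ _ W0); apply: (@filterS _ (nbhs r)) => tau h /=.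
by rewrite in_itv/= andbT => ttau; exact: h.
Qed.

Lemma measurable_rnorm_orbit t z : 0 <= t ->
  measurable_fun `[t, +oo[ (fun tau => rnorm re (U tau t z)).
Proof.
move=> t0; apply: subspace_continuous_measurable_fun => //.
move=> r; apply: (@continuous_comp (subspace `[t, +oo[) _ _
  (fun tau => U tau t z) (rnorm re)).
  exact: continuous_orbit.
exact: continuous_rnorm.
Qed.

(** On each side of [t] the function is the norm of an orbit of [U]: starting at
    time [0] from [V(0,t)Q(t)x] before [t], and at time [t] from [P(t)x] after. *)
Lemma measurable_rnorm_Green t x : 0 <= t ->
  measurable_fun (`[0, +oo[ : set R) (fun tau => rnorm re (Green U P tau t x)).
Proof.
move=> t0.
have -> : `[0, +oo[%classic = `[0, t[ `|` [set t] `|` `]t, +oo[ :> set R.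
  apply/seteqP; split => r /=; rewrite !in_itv/= !andbT.
    by move=> ->; case: (ltgtP r t) => [||->]; auto.
  by move=> [[/andP[]|->]|/ltW/(le_trans t0)].
apply/measurable_funU => //; first exact: measurableU.
split; first (apply/measurable_funU => //; split; last exact: measurable_fun_set1).
- apply: (@eq_measurable_fun _ _ _ _ _ (fun tau => rnorm re (U tau 0 (V U P 0 t (Q P t x))))).
    move=> r; rewrite inE/= in_itv/= => /andP[r0 rt].
    have D : 0 <= r <= t by rewrite r0 ltW.
    by rewrite /Green ltNge (ltW rt)/= rt rnormN (V_transport D (Q_Ker x t0)).
  apply: measurable_funS (measurable_rnorm_orbit _ (lexx 0)) => //.
  exact: subset_itvl.
- apply: (@eq_measurable_fun _ _ _ _ _ (fun tau => rnorm re (U tau t (P t x)))).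
    by move=> r; rewrite inE/= in_itv/= andbT /Green => ->.
  apply: measurable_funS (measurable_rnorm_orbit _ t0) => //.
  by move=> r /=; rewrite !in_itv/= !andbT; exact: ltW.
Qed.

(** The weight of [V(tau,t)Q(t)] is [e^(alpha tau)] with [tau <= t], so
    [alpha >= 0] makes one bound at the base time [t] valid on both sides. *)
Lemma rnorm_Green_le N alpha beta : 0 <= N -> 0 <= alpha ->
  (forall t s, Delta (t, s) ->
     opnorm re (U t s \o P s)
       <= N * expR (alpha * s) * expR (- (beta * (t - s))) /\
     opnorm re (V U P s t \o Q P t)
       <= N * expR (alpha * s) * expR (- (beta * (t - s)))) ->
  forall t tau x, 0 <= t -> 0 <= tau ->
  rnorm re (Green U P tau t x)
    <= N * expR (alpha * t) * expR (- (beta * `|tau - t|)) * rnorm re x.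
Proof.
move=> N0 a0 hN t tau x t0 tau0; have x0 := rnorm_ge0 hK x.
rewrite /Green; case: (ltgtP tau t) => [lt|lt|_].
- have D : 0 <= tau <= t by rewrite tau0 ltW.
  rewrite rnormN; apply: (le_trans (ler_opnorm_unstable x D)).
  have [_ h] := hN t tau (conj tau0 (ltW lt)).
  apply: ler_wpM2r => //; apply: (le_trans h).
  rewrite distrC ger0_norm ?subr_ge0 ?(ltW lt)// -!mulrA.
  apply: ler_wpM2l => //; apply: ler_wpM2r; first exact: expR_ge0.
  by rewrite ler_expR ler_wpM2l// ltW.
- have D : 0 <= t <= tau by rewrite t0 ltW.
  apply: (le_trans (ler_opnorm_stable x D)).
  have [h _] := hN tau t (conj t0 (ltW lt)).
  by apply: ler_wpM2r => //; rewrite ger0_norm// subr_ge0 ltW.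
- by rewrite rnorm0// !mulr_ge0// ?expR_ge0.
Qed.

End Dichotomy.

(** * From the dichotomy to the integral estimate *)

(* The integral of a nonnegative function is total in the library, hence the
   explicit measurability of the integrand. *)
Theorem proposition3p1 (R : realType) (K : numFieldType) (re : K -> R)
    (hK : scalars re) (X : completeNormedModType K)
    (U : R -> R -> bounded_operator X) (hU : evolution_operator U)
    (p : R) (hp : 0 < p) (P : R -> bounded_operator X)
    (hP : strong_exponential_dichotomy re U P) :
  exponential_growth re U P /\
  exists kappa delta gamma : R,
    [/\ 1 <= kappa, 0 <= delta, 0 < gamma
      & forall (t : R) (x : X), 0 <= t ->
        measurable_fun (`[0, +oo[ : set R) (fun tau : R =>
          expR (p * gamma * `|tau - t|) * rnorm re (Green U P tau t x) `^ p) /\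
        (\int[lebesgue_measure]_(tau in `[0%R, +oo[)
           (expR (p * gamma * `|tau - t|)
            * rnorm re (Green U P tau t x) `^ p)%:E
         <= (kappa * expR (p * delta * t) * rnorm re x `^ p)%:E)%E].
Proof.
have [proj comp [N [alpha [beta [N1 a0 b0 hN]]]]] := hP.
have N0 : 0 <= N by exact: le_trans N1.
split.
  split => //; exists N, alpha, beta; split => // t s D.
  have [h1 h2] := hN _ _ D; have [s0 st] := D.
  have le_growth : N * expR (alpha * s) * expR (- (beta * (t - s)))
      <= N * expR (alpha * s) * expR (beta * (t - s)).
    apply: ler_wpM2l; first by rewrite mulr_ge0 ?expR_ge0.
    have : 0 <= beta * (t - s) by rewrite mulr_ge0 ?subr_ge0// ltW.
    by rewrite ler_expR => h; lra.
  by split; [exact: le_trans h1 _|exact: le_trans h2 _].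
have c0 : 0 < p * (beta / 2) by rewrite mulr_gt0// divr_gt0.
(* Half of the rate [beta] goes into the weight; the other half makes the
   integrand decay with total mass [2 / (p * (beta / 2))]. *)
exists (Num.max 1 (N `^ p * (2 / (p * (beta / 2))))), alpha, (beta / 2).
split => //; [by rewrite le_max lexx|by rewrite divr_gt0|move=> t x t0].
have x0 := rnorm_ge0 hK x.
have mdist (a : R) : measurable_fun setT (fun tau : R => expR (a * `|tau - t|)).
  apply: continuous_measurable_fun; have := @continuous_expR_dist R (- a) t.
  by under eq_fun do rewrite mulNr opprK.
have mG : measurable_fun (`[0, +oo[ : set R) (fun tau : R =>
    expR (p * (beta / 2) * `|tau - t|) * rnorm re (Green U P tau t x) `^ p).
  apply: measurable_funM; first exact: measurable_funTS (mdist _).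
  apply: (measurableT_comp (measurable_powR p)).
  exact: measurable_rnorm_Green.
split => //.
set C := N `^ p * expR (p * alpha * t) * rnorm re x `^ p.
have C0 : 0 <= C by rewrite !mulr_ge0 ?powR_ge0 ?expR_ge0.
have mE : measurable_fun setT
    (fun tau : R => (expR (- (p * (beta / 2) * `|tau - t|)))%:E).
  apply/measurable_EFinP; have := mdist (- (p * (beta / 2))).
  by under eq_fun do rewrite mulNr.
apply: (@le_trans _ _ (\int[lebesgue_measure]_(tau in `[0%R, +oo[)
    (C%:E * (expR (- (p * (beta / 2) * `|tau - t|)))%:E))%E).
  apply: ge0_le_integral => //=.
  - by move=> tau _; rewrite lee_fin mulr_ge0 ?powR_ge0 ?expR_ge0.
  - exact/measurable_EFinP.
  - by apply: measurable_funeM; exact: measurable_funTS.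
  move=> tau; rewrite in_itv/= andbT => tau0; rewrite -EFinM lee_fin.
  have G0 := rnorm_ge0 hK (Green U P tau t x).
  have h := rnorm_Green_le hK proj comp N0 a0 hN x t0 tau0.
  have {}h : rnorm re (Green U P tau t x) `^ p
      <= C * expR (- (p * beta * `|tau - t|)).
    apply: (le_trans (ge0_ler_powR (ltW hp) _ _ h)).
      by rewrite nnegrE.
      by rewrite nnegrE !mulr_ge0 ?expR_ge0.
    rewrite !powRM ?mulr_ge0 ?expR_ge0//.
    rewrite -!expRM /C mulrAC.
    have -> : alpha * t * p = p * alpha * t by ring.
    by have -> : - (beta * `|tau - t|) * p = - (p * beta * `|tau - t|) by ring.
  have := ler_wpM2l (expR_ge0 (p * (beta / 2) * `|tau - t|)) h.
  rewrite (mulrCA _ C) -expRD => /le_trans; apply; apply: ler_wpM2l => //.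
  by rewrite ler_expR; lra.
apply: (@le_trans _ _ (\int[lebesgue_measure]_tau
    (C%:E * (expR (- (p * (beta / 2) * `|tau - t|)))%:E))%E).
  apply: ge0_subset_integral => //=.
  - exact: measurable_funeM.
  - by move=> tau _; rewrite mule_ge0 ?lee_fin ?expR_ge0.
rewrite ge0_integralZl//.
rewrite integral_expR_dist// -EFinM lee_fin /C.
set k := 2 / _.
have -> : N `^ p * expR (p * alpha * t) * rnorm re x `^ p * k
  = N `^ p * k * (expR (p * alpha * t) * rnorm re x `^ p) by ring.
rewrite -[leRHS]mulrA ler_wpM2r ?mulr_ge0 ?expR_ge0 ?powR_ge0//.
by rewrite le_max lexx orbT.
Qed.
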